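(* Let $p$ be a prime and $q$ a prime power with $q\equiv1 \pmod{p}$. Then $$(q-1)\left(h(q,z)-\frac{1}{p}h(q^p,z^p)\right)\in \mathbb{Z}_p[[z]].$$
   Context: For a number $Q$ (here a power of a prime power), $h(Q,z)=\log f(Q,z)\in\mathbb{Q}[[z]]$, where $f(Q,z)=\sum_{n\geq0}\frac{(-1)^nz^n}{Q^{\binom{n}{2}}(Q;Q)_n}$ and $(Q;Q)_n=\prod_{i=1}^n(1-Q^i)$. $\mathbb{Z}_p$ denotes the $p$-adic integers. *)

(* Defs.v *)
From mathcomp Require Import all_boot all_order all_algebra.

Set Implicit Arguments.
Unset Strict Implicit.
Unset Printing Implicit Defensive.

Import Order.TTheory GRing.Theory Num.Theory.
Local Open Scope ring_scope.

(* An element of Q[[z]] is the sequence of its coefficients. *)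
Definition fps := nat -> rat.

Definition fps_one : fps := fun n => (n == 0%N)%:R.

Definition fps_sub (a b : fps) : fps := fun n => a n - b n.

Definition fps_scale (c : rat) (a : fps) : fps := fun n => c * a n.

Definition fps_mul (a b : fps) : fps :=
  fun n => \sum_(i < n.+1) a i * b (n - i)%N.

Definition fps_exp (a : fps) (k : nat) : fps := iter k (fps_mul a) fps_one.

(* The substitution z := z^m, for m > 0. *)
Definition fps_subst_pow (m : nat) (a : fps) : fps :=
  fun n => if (m %| n)%N then a (n %/ m)%N else 0.

(* log a = \sum_(k >= 1) (-1)^(k-1) / k * (a - 1)^k, for a with constant
   coefficient 1. Then (a - 1)^k has no term of degree < k, so only the terms
   with k <= n contribute to the coefficient of z^n. *)
Definition fps_log (a : fps) : fps :=
  fun n => \sum_(1 <= k < n.+1)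
    (-1) ^+ k.-1 / k%:R * fps_exp (fps_sub a fps_one) k n.

(* (Q; Q)_n *)
Definition qpoch (Q : rat) (n : nat) : rat := \prod_(1 <= i < n.+1) (1 - Q ^+ i).

Definition fser (Q : rat) : fps :=
  fun n => (-1) ^+ n / (Q ^+ 'C(n, 2) * qpoch Q n).

Definition hser (Q : rat) : fps := fps_log (fser Q).

Definition prime_power (q : nat) : Prop :=
  exists l k : nat, [/\ prime l, (0 < k)%N & q = (l ^ k)%N].

(* Meaningful for p prime and x != 0. *)
Definition padic_val (p : nat) (x : rat) : int :=
  (logn p `|numq x|%N)%:Z - (logn p `|denq x|%N)%:Z.

Definition padic_norm (p : nat) (x : rat) : rat :=
  if x == 0 then 0 else p%:R ^ (- padic_val p x).

(* Z_p is the closed unit ball of Q_p, and the norm of Q_p restricts to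
   padic_norm p on Q; hence this is membership in Z_p for a rational x. *)
Definition in_Zp (p : nat) (x : rat) : Prop := padic_norm p x <= 1.

Definition fps_over_Zp (p : nat) (a : fps) : Prop := forall n, in_Zp p (a n).

(* Main.v *)
Require Import Defs.
From mathcomp Require Import all_boot all_order all_algebra all_field.
From mathcomp Require Import ring zify.

(** Put x = 1/Q. Since f(Qz) = f(z) + z f(xz), the quotient g(z) = f(Qz)/f(z)
    satisfies g(z) g(xz) = g(xz) + z, so its coefficients are integral
    polynomials in x, and so are the coefficients a_n(x) of z g'(z)/g(z), where
    a_n(1/Q) = n (Q^n - 1) [z^n] h(Q, z). Up to the factor n (q^n - 1), the n-th
    coefficient of h(q, z) - h(q^p, z^p)/p is thus the value at x = 1/q of
    B(x) = a_n(x) - [p | n] a_{n/p}(x^p). Write n = p^s m with p not dividing m.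
    - B is divisible by p^s (Gauss congruence): additive combinations of the
      logarithmic derivatives of the 1 - x^j z^k produce all those of series with
      constant term 1, and for 1 - x^j z^k the congruence is immediate.
    - If w is a primitive d-th root of unity and d | n, then a_n(w) = a_{n/d}(1):
      the product of the g(w^i z) over i < d is a root of Y^2 = Y + z^d, hence it
      is the series g at x = 1 evaluated at z^d. Consequently B vanishes at the
      n-th roots of unity that are not m-th roots of unity.
    Together, (x^m - 1) B(x) = p^s (x^n - 1) T(x) with T integral. At x = 1/q the
    factor n (q^n - 1) is cancelled, and what remains in the denominator,
    m (q^m - 1)/(q - 1) up to powers of q, is prime to p as q = 1 mod p. *)

Set Implicit Arguments.
Unset Strict Implicit.
Unset Printing Implicit Defensive.

Import GRing.Theory Num.Theory.
Local Open Scope ring_scope.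

(** * Truncated power series *)

Section TruncatedSeries.

Variable R : comNzRingType.
Implicit Types (p q A B F G H U W : {poly R}) (N i j d : nat).

(** Power series are handled as polynomials modulo ['X^N]: [vanish N (p - q)]
    expresses that [p] and [q] agree below degree [N]. *)
Definition vanish N p := forall i, (i < N)%N -> p`_i = 0.

Definition euler p := 'X * p^`().

Definition dil (c : R) p := p \Po (c *: 'X).

(** [A] is the logarithmic derivative [z G'(z) / G(z)] modulo ['X^N]. *)
Definition logder N A G := vanish N (A * G - euler G).

Lemma coef_euler p i : (euler p)`_i = p`_i *+ i.
Proof. by rewrite /euler coefXM coef_deriv; case: i. Qed.

Lemma eulerM p q : euler (p * q) = euler p * q + p * euler q.
Proof. by rewrite /euler derivM; ring. Qed.

Lemma eulerB p q : euler (p - q) = euler p - euler q.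
Proof. by rewrite /euler derivB mulrBr. Qed.

Lemma coef_dil c p i : (dil c p)`_i = c ^+ i * p`_i.
Proof.
rewrite /dil coef_comp_poly.
under eq_bigr => j _ do rewrite exprZn coefZ coefXn.
case: (ltnP i (size p)) => ip.
  rewrite (bigD1 (Ordinal ip)) //= eqxx mulr1 mulrC big1 ?addr0 // => j nj.
  suff -> : (i == j) = false by rewrite !mulr0.
  by apply/negbTE; apply: contraNneq nj => ij; apply/eqP/val_inj.
rewrite nth_default // mulr0 big1 // => j _.
have -> : (i == j) = false by apply/negbTE; rewrite gtn_eqF ?(leq_trans _ ip).
by rewrite !mulr0.
Qed.

Lemma dilM c p q : dil c (p * q) = dil c p * dil c q.
Proof. exact: comp_polyM. Qed.

Lemma dilB c p q : dil c (p - q) = dil c p - dil c q.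
Proof. exact: comp_polyB. Qed.

Lemma dilX c : dil c 'X = c *: 'X.
Proof. exact: comp_polyX. Qed.

Lemma dilA (c c' : R) p : dil c (dil c' p) = dil (c * c') p.
Proof. by apply/polyP => i; rewrite !coef_dil exprMn mulrA. Qed.

Lemma dil1 p : dil 1 p = p.
Proof. by apply/polyP => i; rewrite coef_dil expr1n mul1r. Qed.

Lemma euler_dil c p : euler (dil c p) = dil c (euler p).
Proof. by apply/polyP => i; rewrite coef_dil !coef_euler coef_dil mulrnAr. Qed.

Lemma coef0M p q : (p * q)`_0 = p`_0 * q`_0.
Proof. by rewrite coefM big_ord1. Qed.

Lemma vanish0 N : vanish N 0.
Proof. by move=> i _; rewrite coef0. Qed.

Lemma vanishD N p q : vanish N p -> vanish N q -> vanish N (p + q).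
Proof. by move=> hp hq i iN; rewrite coefD hp ?hq ?addr0. Qed.

Lemma vanishN N p : vanish N p -> vanish N (- p).
Proof. by move=> hp i iN; rewrite coefN hp ?oppr0. Qed.

Lemma vanishB N p q : vanish N p -> vanish N q -> vanish N (p - q).
Proof. by move=> hp hq; apply/vanishD/vanishN. Qed.

Lemma vanishMl N p q : vanish N q -> vanish N (p * q).
Proof.
move=> hq i iN; rewrite coefM big1 // => j _.
by rewrite hq ?mulr0 // (leq_ltn_trans (leq_subr _ _)).
Qed.

Lemma vanishMr N p q : vanish N p -> vanish N (p * q).
Proof. by rewrite mulrC; apply: vanishMl. Qed.

Lemma vanishW M N p : (M <= N)%N -> vanish N p -> vanish M p.
Proof. by move=> MN hp i iM; rewrite hp // (leq_trans iM). Qed.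

Lemma vanish_euler N p : vanish N p -> vanish N (euler p).
Proof. by move=> hp i iN; rewrite coef_euler hp ?mul0rn. Qed.

Lemma vanish_dil N c p : vanish N p -> vanish N (dil c p).
Proof. by move=> hp i iN; rewrite coef_dil hp ?mulr0. Qed.

Lemma vanish_comp_Xn N d p : (0 < d)%N -> vanish N p -> vanish N (p \Po 'X^d).
Proof.
move=> d0 hp i iN; rewrite coef_comp_poly_Xn //; case: ifP => // _.
by rewrite hp // (leq_ltn_trans (leq_div _ _)).
Qed.

Lemma vanish_mulD M N p q : vanish M p -> vanish N q -> vanish (M + N) (p * q).
Proof.
move=> hp hq i iMN; rewrite coefM big1 // => j _.
case: (ltnP j M) => jM; first by rewrite hp ?mul0r.
by rewrite hq ?mulr0 //; move: (ltn_ord j); lia.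
Qed.

Lemma vanish_exp N p : p`_0 = 0 -> vanish N (p ^+ N).
Proof.
move=> p0; elim: N => [|N IH]; first by [].
by rewrite exprS -add1n; apply: vanish_mulD => // -[].
Qed.

Lemma vanishXn N : vanish N 'X^N.
Proof. by move=> i iN; rewrite coefXn ltn_eqF. Qed.

Lemma vanish1 p : p`_0 = 0 -> vanish 1 p.
Proof. by move=> p0 []. Qed.

(** A series with constant term 1 is a unit: the [i]-th coefficient of [G * W] is that of [W] plus
    terms in the lower coefficients of [W]. *)
Lemma vanish_cancel N G W : G`_0 = 1 -> vanish N (G * W) -> vanish N W.
Proof.
move=> G0 h; elim/ltn_ind => i IH iN; have := h i iN.
rewrite coefM big_ord_recl /= G0 mul1r subn0 big1 ?addr0 // => j _.
by rewrite IH ?mulr0 // /bump /=; move: (ltn_ord j); lia.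
Qed.

Lemma unit_series N G : G`_0 = 1 ->
  exists H, H`_0 = 1 /\ vanish N (G * H - 1).
Proof.
(* The truncated geometric series of [1 / (1 - (1 - G))]. *)
move=> G0; exists (\sum_(k < N.+1) (1 - G) ^+ k); split.
  rewrite coef_sum big_ord_recl expr0 coef1 eqxx big1 ?addr0 // => k _.
  by rewrite exprS coef0M coefB coef1 G0 subrr mul0r.
have -> : G * \sum_(k < N.+1) (1 - G) ^+ k - 1 = - (1 - G) ^+ N.+1.
  by have := subrX1 (1 - G) N.+1; rewrite (_ : 1 - G - 1 = - G); [|ring];
     move/eqP; rewrite subr_eq => /eqP ->; ring.
apply: vanishN; apply: (@vanishW _ N.+1) => //; apply: vanish_exp.
by rewrite coefB coef1 G0 subrr.
Qed.

Lemma logderM N A B F G :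
  logder N A F -> logder N B G -> logder N (A + B) (F * G).
Proof.
rewrite /logder => hA hB.
have -> : (A + B) * (F * G) - euler (F * G)
          = G * (A * F - euler F) + F * (B * G - euler G).
  by rewrite eulerM; ring.
by apply: vanishD; apply: vanishMl.
Qed.

Lemma logder1 N : logder N 0 1.
Proof. by rewrite /logder mul0r /euler derivC mulr0 subr0; apply: vanish0. Qed.

Lemma logder_uniq N A B F G : F`_0 = 1 -> vanish N (F - G) ->
  logder N A F -> logder N B G -> vanish N (A - B).
Proof.
move=> F0 FG hA hB; apply: (@vanish_cancel _ F) => //.
have -> : F * (A - B) = (A * F - euler F) - (B * G - euler G)
    + (euler (F - G)) - B * (F - G) by rewrite eulerB; ring.
apply: vanishB; last exact: vanishMl.
apply: vanishD; last exact: vanish_euler.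
exact: vanishB.
Qed.

Lemma logder_dil N c A G : logder N A G -> logder N (dil c A) (dil c G).
Proof. by move=> h; rewrite /logder euler_dil -dilM -dilB; apply: vanish_dil. Qed.

Lemma logder_exists N G : G`_0 = 1 -> exists A, logder N A G.
Proof.
move=> G0; have [H [_ hH]] := unit_series N G0; exists (euler G * H).
rewrite /logder; have -> : euler G * H * G - euler G = euler G * (G * H - 1) by ring.
exact: vanishMl.
Qed.

Lemma logder_comp_Xn N d A G : (0 < d)%N ->
  logder N A G -> logder N ((A \Po 'X^d) *+ d) (G \Po 'X^d).
Proof.
move=> d0 h; rewrite /logder.
have -> : euler (G \Po 'X^d) = (euler G \Po 'X^d) *+ d.
  apply/polyP => i; rewrite coefMn coef_euler !coef_comp_poly_Xn //.
  case: ifP => [/dvdnP[k ->]|_]; last by rewrite !mul0rn.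
  by rewrite mulnK // coef_euler mulrnA.
rewrite mulrnAl -comp_polyM -mulrnBl -comp_polyB => i iN.
by rewrite coefMn (@vanish_comp_Xn N) // mul0rn.
Qed.

End TruncatedSeries.

(** * The continued fraction and its values at roots of unity *)

(** The functional equation of the continued fraction
    [1 + z / (1 + x z / (1 + x^2 z / ...))], modulo ['X^N]. *)
Definition qcf (R : comNzRingType) (N : nat) (x : R) (G : {poly R}) :=
  G`_0 = 1 /\ vanish N (G * dil x G - dil x G - 'X).

(** One coefficient at a time: as [G] and [dil x G] have constant term 1, subtracting [c z^M] from
    [G] changes the error, up to degree [M], by exactly [- c z^M]. No division occurs, so the
    coefficients stay in [R]. *)
Lemma qcf_exists (R : comNzRingType) (N : nat) (x : R) : exists G, qcf N x G.
Proof.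
elim: N => [|N [G [G0 hG]]]; first by exists 1; rewrite /qcf coef1.
case: N hG => [|N] hG.
  exists 1; split; first by rewrite coef1.
  by case=> // _; rewrite !coefB coefX coef0M !coef_dil coef1 !mulr1 subrr subr0.
set E := _ - 'X in hG; pose M := N.+1; pose c := E`_M.
pose C : {poly R} := c%:P; pose Y : {poly R} := (x ^+ M)%:P.
exists (G - C * 'X^M); split; first by rewrite coefB coefCM coefXn mulr0 subr0.
have -> : dil x (G - C * 'X^M) = dil x G - C * Y * 'X^M.
  rewrite dilB; congr (_ - _); apply/polyP => i.
  rewrite coef_dil -mulrA !coefCM coefXn.
  by case: eqVneq => [->|_]; rewrite ?mulr0 // !mulr1 mulrC.
have -> : (G - C * 'X^M) * (dil x G - C * Y * 'X^M) - (dil x G - C * Y * 'X^M) - 'X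
    = (E - C * 'X^M) - C * Y * ('X^M * (G - 1)) - C * ('X^M * (dil x G - 1))
      + C ^+ 2 * Y * ('X^M * 'X^M) by rewrite /E; ring.
have Xvan (p : {poly R}) : p`_0 = 0 -> vanish M.+1 ('X^M * p).
  by move=> p0; rewrite -addn1; apply: vanish_mulD; [apply: vanishXn|apply: vanish1].
apply: vanishD; last by apply/vanishMl/Xvan; rewrite coefXn.
apply: vanishB; last first.
  by apply/vanishMl/Xvan; rewrite coefB coef_dil coef1 G0 mul1r subrr.
apply: vanishB; last by apply/vanishMl/Xvan; rewrite coefB coef1 G0 subrr.
move=> i; rewrite ltnS leq_eqVlt coefB coefCM coefXn => /predU1P[->|iM].
  by rewrite eqxx mulr1 subrr.
by rewrite hG // ltn_eqF // mulr0 subrr.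
Qed.

Lemma map_dil (R S : comNzRingType) (f : {rmorphism R -> S}) (x : R) p :
  map_poly f (dil x p) = dil (f x) (map_poly f p).
Proof. by apply/polyP => i; rewrite coef_map /= !coef_dil coef_map /= rmorphM rmorphXn. Qed.

Lemma map_euler (R S : comNzRingType) (f : {rmorphism R -> S}) p :
  map_poly f (euler p) = euler (map_poly f p).
Proof. by apply/polyP => i; rewrite coef_map /= !coef_euler coef_map /= rmorphMn. Qed.

Lemma vanish_map (R S : comNzRingType) (f : {rmorphism R -> S}) N p :
  vanish N p -> vanish N (map_poly f p).
Proof. by move=> hp i iN; rewrite coef_map /= hp // rmorph0. Qed.

Lemma qcf_map (R S : comNzRingType) (f : {rmorphism R -> S}) N x G :
  qcf N x G -> qcf N (f x) (map_poly f G).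
Proof.
case=> G0 hG; split; first by rewrite coef_map /= G0 rmorph1.
by have := vanish_map f hG; rewrite !rmorphB rmorphM /= map_dil map_polyX.
Qed.

Lemma logder_map (R S : comNzRingType) (f : {rmorphism R -> S}) N A G :
  logder N A G -> logder N (map_poly f A) (map_poly f G).
Proof. by move/(vanish_map f); rewrite rmorphB rmorphM /= map_euler. Qed.

Section RootOfUnity.

Variables (R : numFieldType) (N d : nat) (w : R) (G : {poly R}).
Hypotheses (N_gt0 : (0 < N)%N) (d_gt0 : (0 < d)%N) (wd : d.-primitive_root w).
Hypothesis hG : qcf N w^-1 G.

Let w_neq0 : w != 0.
Proof. by rewrite (prim_root_eq0 wd) -lt0n. Qed.

(** Continuants: the solution of [u_(i+2) = u_(i+1) + w^(i+1) z u_i] with initial values [a] and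
    [b]. *)
Fixpoint cont (a b : {poly R}) (i : nat) : {poly R} :=
  if i is j.+1 then
    if j is k.+1 then cont a b j + (w ^+ j *: 'X) * cont a b k else b
  else a.

Let alpha := cont 0 1.
Let beta := cont 1 0.

Lemma contSS a b i :
  cont a b i.+2 = cont a b i.+1 + (w ^+ i.+1 *: 'X) * cont a b i.
Proof. by []. Qed.

Let P i := \prod_(j < i) dil (w ^+ j) G.

(** The equation of [G] at [w^(i+1) z] reads [G(w^(i+1) z) G(w^i z) = G(w^i z) + w^(i+1) z];
    multiply it by [P i]. *)
Lemma partial_norm_rec i : vanish N (P i.+2 - P i.+1 - (w ^+ i.+1 *: 'X) * P i).
Proof.
have [_ /(vanish_dil (w ^+ i.+1))] := hG.
rewrite !dilB dilM dilX dilA exprSr mulfK // -exprSr => h.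
have := vanishMl (P i) h; congr (vanish N _).
by rewrite /P !big_ord_recr /=; ring.
Qed.

(** Both sides obey the same recurrence, with initial values 1 and [G]. *)
Lemma partial_normE i : vanish N (P i - (alpha i * G + beta i)).
Proof.
suff [] : vanish N (P i - (alpha i * G + beta i)) /\
          vanish N (P i.+1 - (alpha i.+1 * G + beta i.+1)) by [].
elim: i => [|i [IH1 IH2]].
  rewrite /P big_ord0 big_ord1 expr0 dil1 /=.
  by split; [rewrite mul0r add0r|rewrite mul1r addr0]; rewrite subrr; apply: vanish0.
split=> //; rewrite /alpha /beta !contSS -/alpha -/beta.
have := vanishD (vanishD (partial_norm_rec i) IH2) (vanishMl (w ^+ i.+1 *: 'X) IH1).
by congr (vanish N _); ring.
Qed.

(** The Casoratian of two solutions: each step of the recurrence has determinant [- w^(j+1) z]. *)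
Lemma cont_wronskian i : alpha i.+1 * beta i - alpha i * beta i.+1
  = \prod_(j < i) - (w ^+ j.+1 *: 'X).
Proof.
elim: i => [|i IH]; first by rewrite big_ord0 /=; ring.
by rewrite big_ord_recr -IH /alpha /beta !contSS /=; ring.
Qed.

Lemma cont_wronskian_d : alpha d.+1 * beta d - alpha d * beta d.+1 = - 'X^d.
Proof.
rewrite cont_wronskian.
have -> : \prod_(j < d) - (w ^+ j.+1 *: 'X)
    = (\prod_(j < d) - w ^+ j.+1) *: 'X^d.
  rewrite -[in 'X^d](card_ord d) -prodr_const -scaler_prod.
  by apply: eq_bigr => j _; rewrite scaleNr.
suff -> : \prod_(j < d) - w ^+ j.+1 = -1 by rewrite scaleN1r.
(* The product is read off at 0 from [X^d - 1 = \prod_j (X - w^j)], after a cyclic shift of the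
   indices by [w^d = 1]. *)
have := congr1 (fun p : {poly R} => p.[0]) (factor_Xn_sub_1 wd).
rewrite big_mkord horner_prod hornerD hornerN hornerXn hornerC expr0n.
rewrite gtn_eqF // sub0r => <-.
under [RHS]eq_bigr => j _ do rewrite hornerXsubC sub0r.
case: (d) d_gt0 (prim_expr_order wd) => // e _ we.
by rewrite big_ord_recr big_ord_recl /= we expr0 mulrC.
Qed.

Lemma size_three_term_rec (u : nat -> {poly R}) (c : nat -> R) :
  (forall i, u i.+2 = u i.+1 + (c i *: 'X) * u i) ->
  (size (u 0%N) <= 1)%N -> (size (u 1%N) <= 1)%N ->
  forall i, (size (u i) <= i./2.+1)%N.
Proof.
move=> urec u0 u1 i.
suff [] : (size (u i) <= i./2.+1)%N /\ (size (u i.+1) <= (i.+1)./2.+1)%N by [].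
elim: i => [//|i [IH1 IH2]]; split=> //; rewrite urec.
apply: leq_trans (size_polyD _ _) _; rewrite geq_max; apply/andP; split; first lia.
rewrite -scalerAl; apply: leq_trans (size_scale_leq _ _) _.
by apply: leq_trans (size_polyMleq _ _) _; rewrite size_polyX add2n /= ltnS.
Qed.

(** By [norm_quadratic_trace] and [cont_wronskian_d], [T] and [- 'X^d] are the
    trace and the determinant of the monodromy of the recurrence. *)
Let T := beta d + alpha d.+1.

(** The degree of a continuant grows by at most one every two steps, so [T] has degree at most
    [d / 2]. *)
Lemma size_cont_trace : (size T <= d)%N.
Proof.
have hb : (size (beta d) <= d./2.+1)%N.
  by apply: (@size_three_term_rec _ (fun i => w ^+ i.+1)); rewrite ?size_poly1 ?size_poly0.
have ha : (size (alpha d.+1) <= d./2.+1)%N.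
  apply: (@size_three_term_rec (fun i => alpha i.+1) (fun i => w ^+ i.+2)) => //=.
    by rewrite size_poly1.
  by rewrite /alpha /= mulr0 addr0 size_poly1.
rewrite /T; case: (d) d_gt0 ha hb => [//|[_ _ _|e _ ha hb]].
  by rewrite /alpha /beta /= mulr0 addr0 add0r size_poly1.
by apply: leq_trans (size_polyD _ _) _; rewrite geq_max; apply/andP; split; lia.
Qed.

Let Gam := P d.

Lemma norm_dil_inv : dil w Gam = Gam.
Proof.
rewrite /Gam /P.
have -> : dil w (\prod_(j < d) dil (w ^+ j) G) = \prod_(j < d) dil (w ^+ j.+1) G.
  rewrite {1}/dil rmorph_prod; apply: eq_bigr => j _ /=.
  by rewrite exprS; apply: dilA.
case: (d) d_gt0 (prim_expr_order wd) => // e _ we.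
by rewrite big_ord_recr big_ord_recl /= we expr0 dil1 mulrC.
Qed.

Lemma coef0_norm : Gam`_0 = 1.
Proof.
rewrite /Gam /P; elim: (d) => [|e IH]; first by rewrite big_ord0 coef1.
by rewrite big_ord_recr /= coef0M IH coef_dil hG.1 !mulr1.
Qed.

(** As [w^d = 1], [P d.+1 = Gam * G]. Hence [(1, G)] is an eigenvector, with eigenvalue [Gam], of
    the matrix with rows [(beta d, alpha d)] and [(beta d.+1, alpha d.+1)]; this is its
    characteristic equation. *)
Lemma norm_quadratic_trace : vanish N (Gam ^+ 2 - T * Gam - 'X^d).
Proof.
have h1 : vanish N (Gam - (alpha d * G + beta d)) := partial_normE d.
have : vanish N (P d.+1 - (alpha d.+1 * G + beta d.+1)) := partial_normE d.+1.
rewrite {1}/P big_ord_recr /= prim_expr_order // dil1 -/(P d) -/Gam => h2.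
have -> : Gam ^+ 2 - T * Gam - 'X^d = alpha d * (Gam * G - (alpha d.+1 * G + beta d.+1))
   + (Gam - alpha d.+1) * (Gam - (alpha d * G + beta d)).
  by rewrite -cont_wronskian_d /T; ring.
by apply: vanishD; apply: vanishMl.
Qed.

(** The norm [Gam] is invariant under [z := w z], hence so is
    [T = Gam - 'X^d / Gam]; but [T] has degree less than [d]. *)
Lemma cont_trace1 : vanish N (T - 1).
Proof.
have h : vanish N (Gam * (dil w T - T)).
  have -> : Gam * (dil w T - T) = (Gam ^+ 2 - T * Gam - 'X^d)
      - dil w (Gam ^+ 2 - T * Gam - 'X^d).
    rewrite !dilB !dilM norm_dil_inv.
    have -> : dil w 'X^d = 'X^d.
      apply/polyP => i; rewrite coef_dil coefXn.
      by case: eqP => [->|_]; rewrite ?mulr0 // prim_expr_order ?mulr1.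
    by rewrite -expr2; ring.
  by apply: vanishB; last apply: vanish_dil; apply: norm_quadratic_trace.
(* Invariance says nothing about the constant coefficient, which comes from the quadratic equation
   instead. *)
have {}h := vanish_cancel coef0_norm h; case=> [_|i iN].
  have := norm_quadratic_trace N_gt0.
  rewrite !coefB coefXn expr2 !coef0M coef0_norm !mulr1 coef1 eq_sym gtn_eqF //.
  by rewrite subr0 => /eqP; rewrite subr_eq0 => /eqP <-; rewrite subrr.
rewrite coefB coef1 subr0; case: (ltnP i.+1 d) => id.
  have := h _ iN; rewrite coefB coef_dil -{2}[T`_i.+1]mul1r -mulrBl.
  move/eqP; rewrite mulf_eq0 subr_eq0 -(prim_order_dvd wd) => /orP[dv|/eqP//].
  by have := dvdn_leq (ltn0Sn i) dv; rewrite leqNgt id.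
by rewrite nth_default // (leq_trans size_cont_trace).
Qed.

(** [Gam] and [H = G1(z^d)] are both roots of [Y^2 - Y - z^d], so [(Gam + H - 1) (Gam - H) = 0], and
    the first factor has constant term 1. *)
Lemma norm_qcf (G1 : {poly R}) : qcf N 1 G1 -> vanish N (Gam - (G1 \Po 'X^d)).
Proof.
case=> G10; rewrite dil1 => /(vanish_comp_Xn d_gt0).
rewrite !comp_polyB comp_polyM comp_polyX; set H := G1 \Po 'X^d => hH.
have H0 : H`_0 = 1 by rewrite coef_comp_poly_Xn // dvdn0 div0n.
apply: (@vanish_cancel _ _ (Gam + H - 1)).
  by rewrite coefB coefD coef1 coef0_norm H0 addrK.
have -> : (Gam + H - 1) * (Gam - H) = (Gam ^+ 2 - T * Gam - 'X^d)
   - (H * H - H - 'X^d) + Gam * (T - 1) by ring.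
apply: vanishD; last by apply/vanishMl/cont_trace1.
by apply: vanishB => //; apply: norm_quadratic_trace.
Qed.

(** Compare the logarithmic derivatives of the two sides of [norm_qcf]: in degrees divisible by [d],
    the sum over the dilations and the substitution [z := z^d] each contribute a factor [d], which
    cancels. *)
Lemma coef_logder_root_unity A A1 G1 n : qcf N 1 G1 ->
  logder N A G -> logder N A1 G1 -> (n < N)%N -> (d %| n)%N ->
  A`_n = A1`_(n %/ d).
Proof.
move=> hG1 hA hA1 nN dn.
have hS : logder N (\sum_(j < d) dil (w ^+ j) A) Gam.
  rewrite /Gam /P; elim: (d) => [|e IH]; first by rewrite !big_ord0; apply: logder1.
  by rewrite !big_ord_recr; apply: logderM => //; apply: logder_dil.
have := logder_uniq coef0_norm (norm_qcf hG1) hS (logder_comp_Xn d_gt0 hA1) nN.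
rewrite coefB coef_sum coefMn coef_comp_poly_Xn // dn.
have wn1 : w ^+ n == 1 by rewrite -(prim_order_dvd wd).
under eq_bigr => j _ do
  rewrite coef_dil -exprM mulnC exprM (eqP wn1) expr1n mul1r.
rewrite sumr_const card_ord -mulrnBl => /eqP; rewrite mulrn_eq0 eqn0Ngt d_gt0 /=.
by rewrite subr_eq0 => /eqP.
Qed.

End RootOfUnity.

(** * Gauss congruences *)

Section GaussCongruence.

Variables (p N : nat).
Hypothesis p_prime : prime p.
Implicit Types (A B F G H : {poly {poly int}}) (c : {poly int}).

(** The outer variable is [z], the inner one [x]: this is the [n]-th coefficient of
    [A(x, z) - A(x^p, z^p)]. *)
Definition gauss_coef A n : {poly int} :=
  A`_n - (if (p %| n)%N then A`_(n %/ p) \Po 'X^p else 0).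

Definition gauss_cong A := forall n, (0 < n < N)%N ->
  exists b : {poly int}, gauss_coef A n = b *+ p ^ logn p n.

Definition gauss_logder G := forall A, logder N A G -> gauss_cong A.

Lemma gauss_coefB A B n : gauss_coef (A - B) n = gauss_coef A n - gauss_coef B n.
Proof.
by rewrite /gauss_coef !coefB; case: ifP => _; rewrite ?comp_polyB; ring.
Qed.

Lemma gauss_congB A B : gauss_cong A -> gauss_cong B -> gauss_cong (A - B).
Proof.
move=> hA hB n n0; have [[a ha] [b hb]] := (hA n n0, hB n n0).
by exists (a - b); rewrite gauss_coefB ha hb mulrnBl.
Qed.

Lemma gauss_cong_vanish A : vanish N A -> gauss_cong A.
Proof.
move=> hA n /andP[n0 nN]; exists 0; rewrite mul0rn /gauss_coef !hA //.
  by rewrite comp_poly0 if_same subrr.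
by rewrite (leq_ltn_trans (leq_div _ _)).
Qed.

Lemma gauss_congD A B : gauss_cong A -> gauss_cong B -> gauss_cong (A + B).
Proof.
move=> hA hB; rewrite (_ : A + B = A - (0 - B)); last by ring.
by apply/gauss_congB/gauss_congB => //; apply/gauss_cong_vanish/vanish0.
Qed.

Lemma gauss_logderM F G : F`_0 = 1 -> G`_0 = 1 ->
  gauss_logder F -> gauss_logder G -> gauss_logder (F * G).
Proof.
move=> F0 G0 hF hG A hA; have [[B hB] [C hC]] := (logder_exists N F0, logder_exists N G0).
have FG0 : (F * G)`_0 = 1 by rewrite coef0M F0 G0 mulr1.
have FGv : vanish N (F * G - F * G) by rewrite subrr; apply: vanish0.
rewrite -[A](subrK (B + C)); apply: gauss_congD.
  exact/gauss_cong_vanish/(logder_uniq FG0 FGv hA (logderM hB hC)).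
by apply: gauss_congD; [apply: hF|apply: hG].
Qed.

Lemma gauss_logder_div F G : F`_0 = 1 -> G`_0 = 1 ->
  gauss_logder F -> gauss_logder (F * G) -> gauss_logder G.
Proof.
move=> F0 G0 hF hFG A hA; have [B hB] := logder_exists N F0.
rewrite (_ : A = (B + A) - B); last by ring.
by apply: gauss_congB; [apply/hFG/logderM|apply: hF].
Qed.

Lemma gauss_logder1 G : vanish N (G - 1) -> gauss_logder G.
Proof.
move=> hG A hA; apply: gauss_cong_vanish.
have h : vanish N (1 - G) by rewrite -opprB; apply: vanishN.
have := logder_uniq _ h (@logder1 _ N) hA.
by rewrite coef1 sub0r => /(_ erefl)/vanishN; rewrite opprK.
Qed.

(** The logarithmic derivative is [- k \sum_(r >= 1) x^(j r) z^(k r)]. If [k] divides [n / p], the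
    two terms of [gauss_coef] cancel; if [k] divides only [n], then [n / k] is prime to [p], so [k]
    carries the full power of [p] in [n]. *)
Lemma gauss_logder_factor j k : (0 < k)%N ->
  gauss_logder (1 - ('X^j)%:P * 'X^k).
Proof.
move=> k0 A hA; pose Y : {poly {poly int}} := ('X^j)%:P * 'X^k.
pose B := - (Y * \sum_(r < N) Y ^+ r) *+ k.
have Y0 : Y`_0 = 0 by rewrite coefCM coefXn eq_sym gtn_eqF // mulr0.
have hB : logder N B (1 - Y).
  have eY : euler (1 - Y) = - Y *+ k.
    apply/polyP => i; rewrite coef_euler coefMn coefN coefB coefCM coefXn coef1.
    case: (eqVneq i k) => [->|_]; first by rewrite gtn_eqF // mulr0n sub0r.
    by rewrite mulr0 subr0 oppr0 mul0rn; case: i => [|i] //; rewrite mulr0n mul0rn.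
  rewrite /logder eY.
  have -> : B * (1 - Y) - - Y *+ k = Y * Y ^+ N *+ k.
    rewrite /B mulrnAl -mulrnBl; congr (_ *+ _).
    have := subrX1 Y N; set S := \sum_(_ < _) _ => /eqP; rewrite subr_eq => /eqP ->.
    by ring.
  by rewrite -mulrnAl; apply/vanishMl/vanish_exp.
have YX r : Y ^+ r = ('X^(j * r))%:P * 'X^(k * r).
  by rewrite exprMn -rmorphXn -!exprM.
have Bn n : (0 < n < N)%N ->
    B`_n = if (k %| n)%N then - 'X^(j * (n %/ k)) *+ k else 0.
  move=> /andP[n0 nN]; rewrite coefMn coefN mulr_sumr coef_sum.
  under eq_bigr => r _ do rewrite -exprS YX coefCM coefXn.
  case: ifP => [/dvdnP[m nE]|kn]; last first.
    rewrite big1 ?oppr0 ?mul0rn // => r _; case: eqP => [nE|_]; last by rewrite mulr0.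
    by rewrite nE dvdn_mulr in kn.
  have m0 : (0 < m)%N by case: m nE n0 => // ->.
  have mN : (m.-1 < N)%N.
    by rewrite prednK // ltnW // (leq_ltn_trans _ nN) // nE leq_pmulr.
  rewrite (bigD1 (Ordinal mN)) //= prednK // nE [(m * k)%N]mulnC eqxx mulr1 mulKn //.
  rewrite big1 ?addr0 // => r nr; rewrite eqn_pmul2l //.
  case: eqP => [mE|_]; last by rewrite mulr0.
  by case/eqP: nr; apply/val_inj; rewrite /= mE.
have G0 : (1 - Y)`_0 = 1 by rewrite coefB Y0 coef1 subr0.
have GG : vanish N ((1 - Y) - (1 - Y)) by rewrite subrr; apply: vanish0.
rewrite -[A](subrK B); apply: gauss_congD.
  by apply: gauss_cong_vanish; apply: logder_uniq G0 GG hA hB.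
move=> n n0N; have /andP[n0 nN] := n0N.
rewrite /gauss_coef Bn //.
have [pn|pn] := boolP (p %| n)%N; last first.
  rewrite subr0 (_ : logn p n = 0)%N ?expn0; first by eexists; rewrite mulr1n.
  by apply/eqP; rewrite -leqn0 leqNgt logn_gt0 mem_primes p_prime n0 (negbTE pn).
have [m nE] := dvdnP pn; have p0 := prime_gt0 p_prime.
have m0 : (0 < m)%N by case: (m) nE n0 => // ->.
have mN : (0 < m < N)%N.
  by rewrite m0 (leq_ltn_trans _ nN) // nE leq_pmulr.
rewrite nE mulnK // Bn //.
have [km|km] := boolP (k %| m)%N.
  rewrite dvdn_mulr //; exists 0; rewrite mul0rn.
  apply/eqP; rewrite subr_eq0 raddfMn raddfN /= comp_Xn_poly -exprM; apply/eqP.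
  rewrite -divn_mulAC // mulnA [(p * _)%N]mulnC; reflexivity.
rewrite [X in _ - X](_ : _ = 0); last exact: comp_poly0.
rewrite subr0; case: ifP => [kn|_]; last by exists 0; rewrite mul0rn.
suff /dvdnP[l ->] : (p ^ logn p (m * p) %| k)%N.
  by rewrite mulrnA; eexists.
have k_n0 : (0 < m * p)%N by rewrite muln_gt0 m0.
have [l kl] := dvdnP kn.
have l0 : (0 < l)%N by case: (l) kl k_n0 => // ->.
have pl : ~~ (p %| l)%N.
  apply: contra km => /dvdnP[t lE]; apply/dvdnP; exists t.
  by apply/eqP; rewrite -(eqn_pmul2r p0) kl lE mulnAC.
rewrite kl lognM // (_ : logn p l = 0)%N ?add0n ?pfactor_dvdnn //.
by apply/eqP; rewrite -leqn0 leqNgt logn_gt0 mem_primes p_prime l0 (negbTE pl).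
Qed.

(** For series [1 + c z^k + ...], products add the coefficients [c] and inverses negate them, while
    [1 - x^j z^k] realizes [- x^j]. The [x^j] generate the additive group of integral
    polynomials. *)
Lemma gauss_logder_monomial k c : (0 < k)%N ->
  exists H, [/\ H`_0 = 1, gauss_logder H & vanish k.+1 (H - 1 - c%:P * 'X^k)].
Proof.
move=> k0; have Xk0 : ('X^k : {poly {poly int}})`_0 = 0.
  by rewrite coefXn eq_sym gtn_eqF.
have XM (P : {poly {poly int}}) : P`_0 = 0 -> vanish k.+1 ('X^k * P).
  by move=> P0; rewrite -addn1; apply: vanish_mulD; [apply: vanishXn|apply: vanish1].
pose S c := exists H,
  [/\ H`_0 = 1, gauss_logder H & vanish k.+1 (H - 1 - c%:P * 'X^k)].
rewrite -/(S c).
have S0 : S 0.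
  exists 1; split; first by rewrite coef1.
    by apply: gauss_logder1; rewrite subrr; apply: vanish0.
  by rewrite subrr polyC0 mul0r subrr; apply: vanish0.
have SD a b : S a -> S b -> S (a + b).
  move=> [F [F0 gF hF]] [G [G0 gG hG]]; exists (F * G); split.
  - by rewrite coef0M F0 G0 mulr1.
  - exact: gauss_logderM.
  have -> : F * G - 1 - (a + b)%:P * 'X^k = (F - 1 - a%:P * 'X^k) * G
      + (1 + a%:P * 'X^k) * (G - 1 - b%:P * 'X^k)
      + a%:P * b%:P * ('X^k * 'X^k) by rewrite polyCD; ring.
  apply: vanishD; last exact/vanishMl/XM.
  by apply: vanishD; [apply: vanishMr|apply: vanishMl].
have SN a : S a -> S (- a).
  move=> [F [F0 gF hF]]; have [G [G0 hG]] := unit_series (maxn N k.+1) F0.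
  exists G; split=> //.
    apply: (gauss_logder_div F0) => //; apply: gauss_logder1.
    by apply: vanishW hG; apply: leq_maxl.
  apply: (vanish_cancel F0).
  have -> : F * (G - 1 - (- a)%:P * 'X^k) = (F * G - 1) - (F - 1 - a%:P * 'X^k)
      + a%:P * ('X^k * (F - 1)) by rewrite polyCN; ring.
  apply: vanishD; last by apply/vanishMl/XM; rewrite coefB coef1 F0 subrr.
  by apply: vanishB => //; apply: vanishW hG; apply: leq_maxr.
have SX j : S (- 'X^j).
  exists (1 - ('X^j)%:P * 'X^k); split.
  - by rewrite coefB coefCM Xk0 coef1 mulr0 subr0.
  - exact: gauss_logder_factor.
  by rewrite polyCN [_ - _ - 1]addrAC subrr sub0r mulNr subrr; apply: vanish0.
have SMn a n : S a -> S (a *+ n).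
  by move=> Sa; elim: n => [//|n IH]; rewrite mulrS; apply: SD.
rewrite -[c]coefK poly_def; elim/big_ind: _ => // i _.
rewrite -[c`_i]intz scaler_int; case: (c`_i) => n.
  by apply: SMn; rewrite -[X in S X]opprK; apply: SN.
by rewrite NegzE mulrNz -mulNrz; apply: SMn.
Qed.

Lemma gauss_logder_series G : G`_0 = 1 -> gauss_logder G.
Proof.
move=> G0.
(* Multiplying [F] by a suitable [H] kills its first nonconstant term, until [F] is 1 modulo [X^N];
   [t] bounds the number of remaining degrees. *)
suff main k t F : F`_0 = 1 -> (0 < k)%N -> (N <= k + t)%N ->
    vanish k (F - 1) -> gauss_logder F.
  apply: (main 1%N N) => //.
  by apply: vanish1; rewrite coefB coef1 G0 subrr.
elim: t k F => [|t IH] k F F0 k0 Nkt hF.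
  by apply: gauss_logder1; apply: vanishW hF; rewrite addn0 in Nkt.
pose c := F`_k; have [H [H0 gH hH]] := gauss_logder_monomial (- c) k0.
apply: (gauss_logder_div H0) => //.
apply: (IH k.+1) => //; first by rewrite coef0M H0 F0 mulr1.
  by rewrite addSnnS.
have -> : H * F - 1 = (H - 1 - (- c)%:P * 'X^k) * F + (F - 1 - c%:P * 'X^k)
    - c%:P * ('X^k * (F - 1)) by rewrite polyCN; ring.
apply: vanishB; last first.
  apply: vanishMl; rewrite -addn1; apply: vanish_mulD; first exact: vanishXn.
  by apply: vanish1; rewrite coefB coef1 F0 subrr.
apply: vanishD; first exact: vanishMr.
move=> i; rewrite ltnS leq_eqVlt coefB coefCM coefXn => /predU1P[->|ik].
  by rewrite eqxx mulr1 coefB coef1 gtn_eqF // subr0 subrr.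
by rewrite hF // ltn_eqF // mulr0 subrr.
Qed.

End GaussCongruence.

(** * Divisibility by cyclotomic factors *)

Definition eval_int (R : comNzRingType) (z : R) : {rmorphism {poly int} -> R} :=
  horner_eval z \o map_poly intr.

Lemma eval_intE (R : comNzRingType) (z : R) P :
  eval_int z P = (map_poly intr P).[z].
Proof. by []. Qed.

Lemma eval_intX (R : comNzRingType) (z : R) : eval_int z 'X = z.
Proof. by rewrite eval_intE map_polyX hornerX. Qed.

Lemma eval_int_comp_Xn (R : comNzRingType) (z : R) P k :
  eval_int z (P \Po 'X^k) = eval_int (z ^+ k) P.
Proof. by rewrite !eval_intE map_comp_poly map_polyXn horner_comp hornerXn. Qed.

Lemma prim_rootV (F : fieldType) (d : nat) (z : F) :
  d.-primitive_root z -> d.-primitive_root z^-1.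
Proof.
move=> zd; have d0 := prim_order_gt0 zd.
have -> : z^-1 = z ^+ d.-1.
  have z0 : z != 0 by rewrite (prim_root_eq0 zd) -lt0n.
  by apply: (mulfI z0); rewrite divff // -exprS prednK // prim_expr_order.
by rewrite prim_root_exp_coprime // -{2}(prednK d0) coprimenS.
Qed.

(** Division by a monic polynomial stays integral, and the remainder, of degree less than [n], has
    [n] distinct roots. *)
Lemma int_poly_dvd_Xn_sub_1 (P : {poly int}) n : (0 < n)%N ->
  (forall z : algC, z ^+ n = 1 -> eval_int z P = 0) ->
  exists T, P = T * ('X^n - 1).
Proof.
move=> n0 Pz; pose D : {poly int} := 'X^n - 1.
have mD : D \is monic by apply: monicXnsubC.
exists (Pdiv.Ring.rdivp P D); rewrite {1}(Pdiv.RingMonic.rdivp_eq mD P).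
suff R0 : map_poly (intr : int -> algC) (Pdiv.Ring.rmodp P D) = 0.
  suff -> : Pdiv.Ring.rmodp P D = 0 by rewrite addr0.
  by apply: (map_inj_poly (intr_inj : injective (intr : int -> algC))); rewrite ?R0 ?rmorph0.
have [w wn] := C_prim_root_exists n0.
apply: (@roots_geq_poly_eq0 _ _ [seq w ^+ (i : nat) | i <- iota 0 n]).
- apply/allP => _ /mapP[i _ ->]; apply/eqP; rewrite -eval_intE.
  have wi : (w ^+ i) ^+ n = 1 by rewrite exprAC (prim_expr_order wn) expr1n.
  have := Pz _ wi; rewrite {1}(Pdiv.RingMonic.rdivp_eq mD P) rmorphD rmorphM.
  by rewrite rmorphB rmorphXn rmorph1 eval_intX wi subrr mulr0 add0r.
- rewrite map_inj_in_uniq; first exact: iota_uniq.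
  move=> i j; rewrite !mem_iota /= => iN jN /eqP.
  by rewrite (eq_prim_root_expr wn) !modn_small // => /eqP.
rewrite size_map size_iota; apply: leq_trans (size_poly _ _) _.
have := Pdiv.Ring.ltn_rmodp P D; rewrite monic_neq0 // => lt.
by rewrite -ltnS (leq_trans lt) // size_XnsubC.
Qed.

Lemma gauss_coef_dvd (p N n : nat) (G A : {poly {poly int}}) :
  prime p -> (0 < n < N)%N -> qcf N 'X G -> logder N A G ->
  exists T : {poly int},
    gauss_coef p A n * ('X^(n %/ p ^ logn p n) - 1)
    = T * ('X^n - 1) *+ p ^ logn p n.
Proof.
move=> p_prime n0N hG hA; have /andP[n0 nN] := n0N.
have N0 : (0 < N)%N by apply: ltn_trans nN.
have p0 := prime_gt0 p_prime.
have [b hb] := gauss_logder_series p_prime hG.1 hA n0N.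
set m := (n %/ p ^ logn p n)%N.
suff [T hT] : exists T, b * ('X^m - 1) = T * ('X^n - 1).
  by exists T; rewrite hb mulrnAl hT.
apply: int_poly_dvd_Xn_sub_1 => // z zn.
rewrite rmorphM rmorphB rmorphXn rmorph1 eval_intX.
have [d zd dn] := prim_order_exists n0 zn.
have [->|zm] := eqVneq (z ^+ m) 1; first by rewrite subrr mulr0.
(* Otherwise the order [d] of [z], a divisor of [n = p^s m], would divide [m]. *)
have pd : (p %| d)%N.
  apply: contraNT zm => pd; rewrite -(prim_order_dvd zd).
  rewrite -(@Gauss_dvdr _ (p ^ logn p n)); last first.
    by rewrite coprime_sym coprimeXl // prime_coprime.
  by rewrite mulnC divnK // pfactor_dvdnn.
have coefE (y : algC) (e k : nat) : e.-primitive_root y -> (k < N)%N -> (e %| k)%N ->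
    eval_int y A`_k = eval_int (1 : algC) A`_(k %/ e).
  move=> ye kN ek; have e0 := prim_order_gt0 ye.
  have hGy : qcf N (y^-1)^-1 (map_poly (eval_int y) G).
    by have := qcf_map (eval_int y) hG; rewrite eval_intX invrK.
  have hG1 : qcf N 1 (map_poly (eval_int (1 : algC)) G).
    by have := qcf_map (eval_int (1 : algC)) hG; rewrite eval_intX.
  have := coef_logder_root_unity N0 e0 (prim_rootV ye) hGy hG1
    (logder_map (eval_int y) hA) (logder_map (eval_int (1 : algC)) hA) kN ek.
  by rewrite !coef_map.
(* As [z] has order [d] and [z^p] has order [d / p], both terms equal the value at 1 of the
   coefficient of index [n / d]. *)
have : eval_int z (gauss_coef p A n) = 0.
  have pn := dvdn_trans pd dn; rewrite /gauss_coef pn rmorphB eval_int_comp_Xn.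
  have [e de] := dvdnP pd; have [l nl] := dvdnP dn.
  have e0 : (0 < e)%N by case: (e) de (prim_order_gt0 zd) => // ->.
  have zpe : e.-primitive_root (z ^+ p).
    have := exp_prim_root zd p; rewrite de gcdnC.
    by have /gcdn_idPr -> := dvdn_mull e (dvdnn p); rewrite mulnK.
  have nEp : (n %/ p = l * e)%N by rewrite nl de mulnA mulnK.
  rewrite (coefE z d) // (coefE (z ^+ p) e) //; last 2 first.
  - by rewrite (leq_ltn_trans (leq_div _ _)).
  - by rewrite nEp dvdn_mull.
  by rewrite nEp mulnK // nl mulnK ?subrr // (prim_order_gt0 zd).
rewrite hb rmorphMn => /eqP; rewrite mulrn_eq0 expn_eq0 eqn0Ngt p0 /=.
by move=> /eqP ->; rewrite mul0r.
Qed.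

(** * The logarithmic derivative of f *)

Definition fps_trunc (N : nat) (a : fps) : {poly rat} := \poly_(i < N) a i.

Lemma coef_fps_trunc N (a : fps) i :
  (fps_trunc N a)`_i = if (i < N)%N then a i else 0.
Proof. exact: coef_poly. Qed.

Lemma fps_exp_trunc N (a : fps) k i : (i < N)%N ->
  fps_exp a k i = (fps_trunc N a ^+ k)`_i.
Proof.
elim: k i => [|k IH] i iN; first by rewrite expr0 coef1.
rewrite /fps_exp iterS -/(fps_exp a k) /fps_mul exprS coefM.
apply: eq_bigr => j _; have jN : (j < N)%N by apply: leq_ltn_trans iN; rewrite -ltnS.
have ijN : (i - j < N)%N by rewrite (leq_ltn_trans (leq_subr _ _)).
by rewrite coef_fps_trunc jN IH.
Qed.

Lemma logder_fps_log N (a : fps) : a 0%N = 1 ->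
  logder N (euler (fps_trunc N (fps_log a))) (fps_trunc N a).
Proof.
move=> a0; case: N => [|N]; first by [].
set F := fps_trunc _ a; pose V := F - 1.
have V0 : V`_0 = 0 by rewrite coefB coef1 coef_fps_trunc a0 subrr.
have VE : fps_trunc N.+1 (fps_sub a fps_one) = V.
  apply/polyP => i; rewrite coefB !coef_fps_trunc coef1 /fps_sub /fps_one.
  by case: (ltnP i N.+1) => //; case: i => // i; rewrite subr0.
pose L := \sum_(k < N) ((-1) ^+ k / k.+1%:R) *: V ^+ k.+1.
(* The extra terms of [L] are powers [V ^+ k.+1] with [k.+1] above the degree considered, so they do
   not contribute. *)
have LE : vanish N.+1 (fps_trunc N.+1 (fps_log a) - L).
  move=> i iN; rewrite coefB coef_fps_trunc iN coef_sum /fps_log big_add1.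
  rewrite (big_nat_widen _ _ N) // big_mkcond big_mkord; apply/eqP.
  rewrite subr_eq0; apply/eqP; apply: eq_bigr => k _.
  rewrite (fps_exp_trunc _ _ iN) VE coefZ; case: ifP => //= /negbT; rewrite -leqNgt.
  by move=> ik; rewrite (@vanish_exp _ k.+1) ?mulr0.
have eV : euler V = euler F by rewrite /V eulerB /euler derivC mulr0 subr0.
(* The derivative of [L] is a geometric sum in [- V]; multiplied by [F = 1 + V] it telescopes. *)
have LF : euler L * F - euler F = - (- V) ^+ N * euler V.
  have -> : euler L = (\sum_(k < N) (- V) ^+ k) * euler V.
    rewrite /euler /L raddf_sum mulr_sumr mulr_suml; apply: eq_bigr => k _.
    rewrite /= derivZ deriv_exp -scaler_nat scalerA divfK ?pnatr_eq0 //.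
    rewrite -[in LHS]signr_odd scaler_sign exprNn -[in RHS]signr_odd mulr_sign.
    by case: (odd k); ring.
  have := subrX1 (- V) N; set S := \sum_(_ < _) _ => /eqP; rewrite subr_eq => /eqP ->.
  by rewrite -eV /V; ring.
rewrite /logder; set E := fps_trunc _ _ in LE *.
have -> : euler E * F - euler F = euler (E - L) * F + (euler L * F - euler F).
  by rewrite eulerB; ring.
apply: vanishD; first by apply/vanishMr/vanish_euler.
rewrite LF -addn1; apply: vanish_mulD.
  by apply/vanishN/vanish_exp; rewrite coefN V0 oppr0.
by apply: vanish1; rewrite coef_euler mulr0n.
Qed.

Lemma fser0 Q : fser Q 0 = 1.
Proof. by rewrite /fser /qpoch big_geq // bin0n expr0 mulr1 invr1 mulr1. Qed.

(** The coefficient form of [f(Q z) - f(z) = z f(z / Q)]. *)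
Lemma fserS (Q : rat) n : Q != 0 -> (forall i, (0 < i)%N -> Q ^+ i != 1) ->
  (Q ^+ n.+1 - 1) * fser Q n.+1 = Q^-1 ^+ n * fser Q n.
Proof.
move=> Q0 Q1; rewrite /fser /qpoch big_nat_recr //= -/(qpoch Q n) binS bin1 exprD.
have P0 : qpoch Q n != 0.
  rewrite /qpoch prodf_seq_neq0; apply/allP => i; rewrite mem_index_iota.
  by move=> /andP[i0 _]; rewrite subr_eq0 eq_sym Q1.
have := Q1 n.+1 (ltn0Sn n); rewrite -subr_eq0 => Qn.
have Qn' : 1 - Q ^+ n.+1 != 0 by rewrite subr_eq0 eq_sym Q1.
have B0 : Q ^+ 'C(n, 2) != 0 by rewrite expf_neq0.
have C0 : Q ^+ n != 0 by rewrite expf_neq0.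
rewrite exprVn [(-1) ^+ n.+1]exprS.
set X := Q ^+ n.+1 in Qn Qn' *; set Y := Q ^+ n in C0 *.
set Z := Q ^+ _ in B0 *; set s := (-1) ^+ n.
by field; rewrite P0 Qn' B0 C0.
Qed.

Lemma fser_functional N (Q : rat) (F := fps_trunc N (fser Q)) :
  Q != 0 -> (forall i, (0 < i)%N -> Q ^+ i != 1) ->
  vanish N (dil Q F - F - 'X * dil Q^-1 F).
Proof.
move=> Q0 Q1 i iN; rewrite !coefB coefXM !coef_dil !coef_fps_trunc iN.
case: i iN => [|i] iN /=; first by rewrite mul1r !subrr.
by rewrite (ltnW iN) -fserS // mulrBl mul1r subrr.
Qed.

(** The functional equations of [G] and [f] give [D W = - z W(z / Q)] modulo [X^N]. Since [D] is a
    unit, vanishing of [W] below degree [k] implies vanishing below [k + 1]. *)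
Lemma qcf_fser N (Q : rat) G (F := fps_trunc N (fser Q)) :
  Q != 0 -> (forall i, (0 < i)%N -> Q ^+ i != 1) -> qcf N Q^-1 G ->
  vanish N (G * F - dil Q F).
Proof.
move=> Q0 Q1 [G0 hG]; set W := _ - _; pose D := dil Q^-1 G.
have hW : vanish N (D * W + 'X * dil Q^-1 W).
  have -> : dil Q^-1 W = D * dil Q^-1 F - F.
    by rewrite /W dilB dilM dilA mulVf // dil1.
  have -> : D * W + 'X * (D * dil Q^-1 F - F) = F * (G * D - D - 'X)
      - D * (dil Q F - F - 'X * dil Q^-1 F) by rewrite /W; ring.
  by apply: vanishB; apply: vanishMl => //; apply: fser_functional.
suff main k : (k <= N)%N -> vanish k W by apply: main.
elim: k => [//|k IH] kN; have D0 : D`_0 = 1 by rewrite coef_dil G0 mulr1.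
apply: (vanish_cancel D0); rewrite -[D * W](addrK ('X * dil Q^-1 W)).
apply: vanishB; first exact: vanishW hW.
rewrite -add1n; apply: vanish_mulD; first by apply: vanish1; rewrite coefX.
by apply/vanish_dil/IH/ltnW.
Qed.

(** Logarithmic differentiation of [G(z) f(z) = f(Q z)] gives [A(z) = E(Q z) - E(z)]. *)
Lemma coef_logder_hser N (Q : rat) A G n :
  Q != 0 -> (forall i, (0 < i)%N -> Q ^+ i != 1) -> qcf N Q^-1 G ->
  logder N A G -> (n < N)%N -> A`_n = (Q ^+ n - 1) * (hser Q n *+ n).
Proof.
move=> Q0 Q1 hG hA nN; set F := fps_trunc N (fser Q).
set E := euler (fps_trunc N (hser Q)).
have hE : logder N E F by apply/logder_fps_log/fser0.
have N0 : (0 < N)%N by apply: leq_ltn_trans nN.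
have F0 : (G * F)`_0 = 1 by rewrite coef0M hG.1 coef_fps_trunc N0 fser0 mulr1.
have := logder_uniq F0 (qcf_fser Q0 Q1 hG) (logderM hA hE) (logder_dil Q hE) nN.
rewrite coefB coefD coef_dil coef_euler coef_fps_trunc nN => /eqP.
by rewrite subr_eq add0r mulrBl mul1r => /eqP <-; rewrite addrK.
Qed.

(** * Conclusion *)

Lemma in_Zp_dvd (p b : nat) (x : rat) : prime p -> coprime p b ->
  x * b%:R \is a Num.int -> in_Zp p x.
Proof.
move=> p_prime pb /intrP[k xb]; rewrite /in_Zp /padic_norm.
case: eqP => // _; rewrite /padic_val.
have p1 : (1 : rat) <= p%:R by rewrite ler1n prime_gt0.
have den : (`|denq x| %| b)%N.
  have : ((numq x * b%:Z)%:~R : rat) = (k * denq x)%:~R.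
    by rewrite !intrM numqE -xb /=; ring.
  move/intr_inj => nbE; rewrite -(@Gauss_dvdr _ `|numq x|%N).
    by have := congr1 absz nbE; rewrite !abszM /= => ->; rewrite dvdn_mull.
  by rewrite coprime_sym coprime_num_den.
have -> : logn p `|denq x| = 0%N.
  rewrite logn_coprime //.
  exact: coprime_dvdr den pb.
rewrite subr0; case: (logn p _) => [|l]; first by [].
rewrite (_ : _ ^ _ = (p%:R ^+ l.+1)^-1) // invf_le1 ?exprn_ege1 //.
by rewrite exprn_gt0 // ltr0n prime_gt0.
Qed.

Lemma eval_intV_int (q : nat) (T : {poly int}) : (0 < q)%N ->
  eval_int (q%:R^-1 : rat) T * q%:R ^+ size T \is a Num.int.
Proof.
move=> q0; have Q0 : q%:R != 0 :> rat by rewrite pnatr_eq0 -lt0n.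
rewrite eval_intE horner_coef mulr_suml; apply: rpred_sum => i _.
have iT : (i <= size T)%N.
  by apply: ltnW; apply: leq_trans (ltn_ord i) _; apply: size_poly.
rewrite coef_map /= -(subnK iT) exprD exprVn mulrACA mulVf ?expf_neq0 // mulr1.
by rewrite rpredM ?rpredX // ?intr_int ?rpred_nat.
Qed.

(** Makes [(q^m - 1) / (q - 1)] prime to [p] whenever [m] is. *)
Lemma sum_expn_mod (p q m : nat) : q = 1 %[mod p] ->
  \sum_(i < m) q ^ i = m %[mod p].
Proof.
move=> q1; elim: m => [|m IH]; first by rewrite big_ord0.
rewrite big_ord_recr /= -modnDm IH -[(q ^ m %% p)%N]modnXm q1 modnXm exp1n modnDm.
by rewrite addn1.
Qed.

Theorem theorem2p8 (p q : nat) (p_prime : prime p) (q_pp : prime_power q)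
    (q_mod_p : q = 1 %[mod p]) :
  fps_over_Zp p
    (fps_scale (q%:R - 1)
       (fps_sub (hser q%:R)
          (fps_scale (p%:R^-1) (fps_subst_pow p (hser (q%:R ^+ p)))))).
Proof.
move=> n; rewrite /fps_scale /fps_sub /fps_subst_pow.
have p0 := prime_gt0 p_prime.
have [->|n0] := posnP n.
  rewrite dvdn0 div0n /hser /fps_log !big_geq // mulr0 subrr mulr0.
  by rewrite /in_Zp /padic_norm eqxx.
set D := hser _ n - _.
have q1 : (1 < q)%N.
  by case: q_pp => l [k [l_prime k0 ->]]; rewrite -(expn0 l) ltn_exp2l ?prime_gt1.
have pq : coprime p q.
  rewrite prime_coprime // /dvdn q_mod_p modn_small ?prime_gt1 //.
pose Q : rat := q%:R; rewrite -/Q in D *.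
have Q0 : Q != 0 by rewrite pnatr_eq0 -lt0n ltnW.
have Qi i : (0 < i)%N -> Q ^+ i != 1.
  by move=> i0; rewrite /Q -natrX pnatr_eq1 -(exp1n i) eqn_exp2r // gtn_eqF.
have [G hG] := qcf_exists n.+1 ('X : {poly int}).
have [A hA] := logder_exists n.+1 hG.1.
have [|T hT] := gauss_coef_dvd p_prime _ hG hA (n := n); first by rewrite n0 ltnS leqnn.
have evA (r : rat) k : r != 0 -> (forall i, (0 < i)%N -> r ^+ i != 1) ->
    (k <= n)%N -> eval_int r^-1 A`_k = (r ^+ k - 1) * (hser r k *+ k).
  move=> r0 ri kn; rewrite -coef_map.
  apply: (coef_logder_hser r0 ri _ (logder_map (eval_int r^-1) hA)) => //.
  by have := qcf_map (eval_int r^-1) hG; rewrite eval_intX.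
(* Both terms share the factor [Q^n - 1], since [(Q^p)^(n/p) = Q^n]; the [1/p] of the statement
   turns [n] into [n / p]. *)
have evD : eval_int Q^-1 (gauss_coef p A n) = (Q ^+ n - 1) * (D *+ n).
  rewrite /gauss_coef /D rmorphB evA //; case: ifP => [pn|_]; last first.
    by rewrite rmorph0 mulr0 !subr0.
  have Qpi i : (0 < i)%N -> (Q ^+ p) ^+ i != 1.
    by move=> i0; rewrite -exprM Qi // muln_gt0 p0.
  rewrite eval_int_comp_Xn exprVn evA ?expf_neq0 ?leq_div // -exprM.
  have P0 : p%:R != 0 :> rat by rewrite pnatr_eq0 -lt0n.
  rewrite [(p * _)%N]mulnC divnK // -mulrBr mulrnBl; congr (_ * (_ - _)).
  set v := hser _ _; rewrite -[in RHS](divnK pn) mulnC mulrnA -[_ *+ p in RHS]mulr_natr.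
  by congr (_ *+ _); field.
set s := logn p n in hT; set m := (n %/ p ^ s)%N in hT.
have nE : (m * p ^ s = n)%N by rewrite divnK // pfactor_dvdnn.
have mn : (m <= n)%N by apply: leq_div.
have m0 : (0 < m)%N by case: (m) nE n0 => // <-.
have pm : coprime p m.
  have [m' pm' nE'] := pfactor_coprime p_prime n0.
  by rewrite /m nE' mulnK ?expn_gt0 ?p0.
pose S := (\sum_(i < m) q ^ i)%N.
have pS : coprime p S.
  by rewrite prime_coprime // /dvdn /S (sum_expn_mod _ q_mod_p) -/(dvdn p m) -prime_coprime.
have SE : Q ^+ m - 1 = (Q - 1) * S%:R.
  by rewrite subrX1 /S natr_sum; congr (_ * _); apply: eq_bigr => i _; rewrite natrX.
set t := eval_int Q^-1 T.
(* Evaluate [hT] at [1/Q] and cancel [(Q^n - 1) p^s]. The signs in [Q^(-k) - 1 = - (Q^k - 1) / Q^k]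
   cancel for [k = m, n], leaving [Q^(n - m)]. *)
have key : (Q - 1) * D * (m%:R * S%:R) * Q ^+ (n - m) = t.
  move: (gauss_coef p A n) evD hT => g evD /(congr1 (eval_int Q^-1)).
  rewrite rmorphMn !rmorphM !rmorphB !rmorphXn rmorph1 eval_intX evD -/t.
  have VX k : Q^-1 ^+ k - 1 = - (Q ^+ k - 1) / Q ^+ k.
    by rewrite exprVn mulNr mulrBl divff ?expf_neq0 // mul1r opprB.
  have Qn : Q ^+ n - 1 != 0 by rewrite subr_eq0 Qi.
  have QnE : Q ^+ n = Q ^+ (n - m) * Q ^+ m by rewrite -exprD subnK.
  have Dn : D *+ n = D * (m%:R * (p ^ s)%:R) by rewrite -natrM nE mulr_natr.
  have Qm : Q ^+ m != 0 by rewrite expf_neq0.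
  have Qnm : Q ^+ (n - m) != 0 by rewrite expf_neq0.
  have ps0 : (p ^ s)%:R != 0 :> rat by rewrite pnatr_eq0 -lt0n expn_gt0 p0.
  have Vn : Q^-1 ^+ n - 1 = - (Q ^+ n - 1) / (Q ^+ (n - m) * Q ^+ m).
    by rewrite -QnE VX.
  rewrite Vn VX SE Dn -[RHS]mulr_natr => h.
  apply: (mulfI (mulf_neq0 Qn ps0)); move: h Qm Qnm.
  set X := Q ^+ n - 1; set Y := Q ^+ m; set Z := Q ^+ (n - m).
  set P := (p ^ s)%:R; move=> h Qm Qnm.
  have := congr1 (fun u => - u * (Z * Y)) h; rewrite /=.
  have -> : - (X * (D * (m%:R * P)) * (- ((Q - 1) * S%:R) / Y)) * (Z * Y)
      = X * P * ((Q - 1) * D * (m%:R * S%:R) * Z) by field.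
  by move=> ->; field; rewrite Qm Qnm.
(* The factor [q^e] clears the denominators of [T(1/q)]; the whole multiplier is prime to [p]. *)
pose e := size T; apply: (@in_Zp_dvd p (m * S * q ^ (n - m + e))%N) => //.
  by rewrite !coprimeMr pm pS coprimeXr.
have -> : (Q - 1) * D * (m * S * q ^ (n - m + e))%N%:R = t * Q ^+ e.
  by rewrite -key !natrM natrX exprD; ring.
by apply: eval_intV_int; apply: ltnW.
Qed.
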